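(* Let $\mathbb{F}$ be a field of characteristic zero and let $\varepsilon > 0$ be a fixed constant. There is an explicit sequence of polynomial maps $\mathcal{G} = (\mathcal{G}_n : \mathbb{F}^{n - n^{1-\varepsilon}} \to \mathbb{F}^n)_{n \in \mathbb{N}}$ such that $\mathcal{G}$ is a $\mathsf{VNC}^0$-computable hitting set generator for $\mathsf{VAC}^0$.
   Context: An arithmetic circuit over $\mathbb{F}$ is a directed acyclic graph whose in-degree-zero vertices (input gates) are labeled by variables or field constants and whose other vertices (internal gates) are labeled $+$ or $\times$; its size is the number of internal gates and its depth is the length of the longest input-to-output path. A $p$-family is a sequence of polynomials $(f_n)_{n\in\mathbb{N}}$ over $\mathbb{F}$ with $\deg f_n$ polynomially bounded in $n$. $\mathsf{VAC}^0$ is the class of $p$-families $(f_n)$ such that $f_n$ is computable by an arithmetic circuit of size $n^{O(1)}$ and depth $O(1)$. $\mathsf{VNC}^0$ is the class of $p$-families $(f_n)$ such that $f_n$ is computable by an arithmetic circuit of size $O(1)$. For a sequence of polynomial maps $\mathcal{G} = (\mathcal{G}_n : \mathbb{F}^{\ell(n)} \to \mathbb{F}^n)_{n}$ with $\mathcal{G}_n = (g_{n,1},\ldots,g_{n,n})$, and classes $\mathscr{C},\mathscr{D}$ of $p$-families, $\mathcal{G}$ is a $\mathscr{D}$-computable hitting set generator for $\mathscr{C}$ if (1) every $p$-family of the form $(g_{n,i_n})_{n}$ lies in $\mathscr{D}$, and (2) for every $p$-family $(f_n)_n \in \mathscr{C}$ and all sufficiently large $n$, $f_n \circ \mathcal{G}_{m(n)}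 = 0$ if and only if $f_n = 0$, where $m(n)$ is the number of variables of $f_n$.
   Formalization: Hitting is claimed only for p-families whose number of variables m(n) satisfies n ≤ m(n)^k + k for some k (false if m(n) = 1: f_n = x − a, with G_1 the constant a); explicit means circuits for G_n are printed in poly(n) time given n and the seed length. *)

(* Defs.v *)
From HB Require Import structures.
From mathcomp Require Import all_boot all_order all_algebra.
From mathcomp Require Import reals.
From mathcomp Require exp.
From mathcomp Require Import mpoly.

Set Implicit Arguments.
Unset Strict Implicit.
Unset Printing Implicit Defensive.
Import Order.TTheory GRing.Theory Num.Theory.

Local Open Scope ring_scope.

(** * Arithmetic circuits

    A circuit is given by its internal gates in topological order together
    with its output vertex.  The in-neighbours of an internal gate are listed
    (fan-in is unbounded); each is an input vertex, labelled by a variable or a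
    constant, or an earlier internal gate [Gate j], numbered from 0. *)

Inductive gate_op := Plus | Times.

Inductive vertex (C : Type) (m : nat) :=
  | Var of 'I_m
  | Const of C
  | Gate of nat.
Arguments Var {C m}.
Arguments Const {C m}.
Arguments Gate {C m}.

Definition gate (C : Type) (m : nat) : Type := gate_op * seq (vertex C m).

Record circuit (C : Type) (m : nat) := Circuit {
  gates : seq (gate C m);
  output : vertex C m }.

Definition vertex_below C m (k : nat) (v : vertex C m) : bool :=
  if v is Gate j then (j < k)%N else true.

Fixpoint gates_wf C m (k : nat) (gs : seq (gate C m)) : bool :=
  if gs is g :: gs' then
    [&& (0 < size g.2)%N, all (vertex_below k) g.2 & gates_wf k.+1 gs']
  else true.

Definition circuit_wf C m (c : circuit C m) : bool :=
  gates_wf 0 (gates c) && vertex_below (size (gates c)) (output c).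

Definition circuit_size C m (c : circuit C m) : nat := size (gates c).

Definition fan_in_le C m (k : nat) (c : circuit C m) : bool :=
  all (fun g => size g.2 <= k)%N (gates c).

Definition vertex_depth C m (ds : seq nat) (v : vertex C m) : nat :=
  if v is Gate j then nth 0%N ds j else 0%N.

Definition gate_depth C m (ds : seq nat) (g : gate C m) : nat :=
  (\max_(v <- g.2) vertex_depth ds v).+1.

Definition circuit_depth C m (c : circuit C m) : nat :=
  vertex_depth (foldl (fun ds g => rcons ds (gate_depth ds g)) [::] (gates c))
    (output c).

Definition vertex_val (F : fieldType) m (ps : seq {mpoly F[m]})
    (v : vertex F m) : {mpoly F[m]} :=
  match v with
  | Var i => 'X_i
  | Const a => a%:MP
  | Gate j => nth 0 ps j
  end.

Definition gate_val (F : fieldType) m (ps : seq {mpoly F[m]})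
    (g : gate F m) : {mpoly F[m]} :=
  match g.1 with
  | Plus => \sum_(v <- g.2) vertex_val ps v
  | Times => \prod_(v <- g.2) vertex_val ps v
  end.

Definition circuit_val (F : fieldType) m (c : circuit F m) : {mpoly F[m]} :=
  vertex_val (foldl (fun ps g => rcons ps (gate_val ps g)) [::] (gates c))
    (output c).

Definition computes (F : fieldType) m (c : circuit F m) (p : {mpoly F[m]}) :=
  circuit_wf c /\ circuit_val c = p.

(** * Families of polynomials

    [f n] is a polynomial in [m n] variables. *)

Definition family (F : fieldType) (m : nat -> nat) : Type :=
  forall n, {mpoly F[m n]}.

Definition family_class (F : fieldType) : Type :=
  forall m : nat -> nat, family F m -> Prop.

(* [msize p] is [deg p + 1] for nonzero [p]. *)
Definition p_family (F : fieldType) : family_class F := fun m f =>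
  exists k, forall n, ((msize (f n)).-1 <= n ^ k + k)%N.

Definition VAC0 (F : fieldType) : family_class F := fun m f =>
  p_family f /\
  exists k d, forall n, exists c : circuit F (m n),
    [/\ computes c (f n), (circuit_size c <= n ^ k + k)%N
      & (circuit_depth c <= d)%N].

(* Fan-in two is the usual convention for NC classes; without it a sum of
   arbitrarily many variables would have size 1. *)
Definition VNC0 (F : fieldType) : family_class F := fun m f =>
  p_family f /\
  exists s, forall n, exists c : circuit F (m n),
    [/\ computes c (f n), fan_in_le 2 c & (circuit_size c <= s)%N].

(** * Hitting set generators *)

Definition poly_map_seq (F : fieldType) (l : nat -> nat) : Type :=
  forall n, n.-tuple {mpoly F[l n]}.

(* Coordinates exist only for positive [n], hence the shift of the index.
   Membership of a coordinate family in [D] includes its being a p-family: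
   coordinates of superpolynomial degree are not exempted. *)
Definition coordinates_in (F : fieldType) (D : family_class F)
    (l : nat -> nat) (G : poly_map_seq F l) : Prop :=
  forall i : (forall n, 'I_n.+1),
    D (fun n => l n.+1) (fun n => tnth (G n.+1) (i n)).

(* The number of variables must grow at least like some power of the index.
   If it were allowed to be bounded, say [m n = 1], no generator with
   [l 1 = 0] could hit: [G 1] is then a constant [a], and ['X - a] vanishes
   on it. *)
Definition hits (F : fieldType) (C : family_class F)
    (l : nat -> nat) (G : poly_map_seq F l) : Prop :=
  forall (m : nat -> nat) (f : family F m),
    (exists k, forall n, (n <= m n ^ k + k)%N) ->
    C m f ->
    exists N, forall n, (N <= n)%N -> (f n \mPo G (m n) = 0 <-> f n = 0).

Definition computable_hsg (F : fieldType) (D C : family_class F)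
    (l : nat -> nat) (G : poly_map_seq F l) : Prop :=
  coordinates_in D G /\ hits C G.

(** * Explicitness

    Polynomial time is measured on a random access machine with unit-cost
    addition and truncated subtraction, presented as a structured language.
    Memory is an array of natural numbers, all of it addressable
    indirectly; in time [t] cell contents have [O(t + log n)] bits, so this is
    polynomially equivalent to Turing machine time. *)

Inductive expr :=
  | Lit of nat
  | Cell of expr
  | Add of expr & expr
  | Sub of expr & expr.

Inductive cmd :=
  | Store of expr & expr
  | Emit of expr
  | Seq of cmd & cmd
  | If of expr & cmd & cmd
  | While of expr & cmd.

Definition memory : Type := nat -> nat.

Fixpoint expr_val (s : memory) (e : expr) : nat :=
  match e with
  | Lit k => k
  | Cell a => s (expr_val s a)
  | Add a b => (expr_val s a + expr_val s b)%N
  | Sub a b => (expr_val s a - expr_val s b)%N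
  end.

Definition update (s : memory) (a v : nat) : memory :=
  fun b => if b == a then v else s b.

(* [exec c s w t s']: run from memory [s], [c] halts after [t] steps in memory
   [s'], having emitted the word [w].  Nonzero means true. *)
Inductive exec : cmd -> memory -> seq nat -> nat -> memory -> Prop :=
  | ExecStore a e s :
      exec (Store a e) s [::] 1 (update s (expr_val s a) (expr_val s e))
  | ExecEmit e s : exec (Emit e) s [:: expr_val s e] 1 s
  | ExecSeq c1 c2 s s1 s2 w1 w2 t1 t2 :
      exec c1 s w1 t1 s1 -> exec c2 s1 w2 t2 s2 ->
      exec (Seq c1 c2) s (w1 ++ w2) (t1 + t2) s2
  | ExecIfTrue e c1 c2 s w t s' :
      expr_val s e != 0%N -> exec c1 s w t s' -> exec (If e c1 c2) s w t.+1 s'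
  | ExecIfFalse e c1 c2 s w t s' :
      expr_val s e = 0%N -> exec c2 s w t s' -> exec (If e c1 c2) s w t.+1 s'
  | ExecWhileTrue e c s s1 s2 w1 w2 t1 t2 :
      expr_val s e != 0%N ->
      exec c s w1 t1 s1 -> exec (While e c) s1 w2 t2 s2 ->
      exec (While e c) s (w1 ++ w2) (t1 + t2).+1 s2
  | ExecWhileFalse e c s :
      expr_val s e = 0%N -> exec (While e c) s [::] 1 s.

Definition input2 (a b : nat) : memory :=
  fun i => match i with 0 => a | 1 => b | _ => 0%N end.

Definition map_vertex C D m (h : C -> D) (v : vertex C m) : vertex D m :=
  match v with
  | Var i => Var i
  | Const a => Const (h a)
  | Gate j => Gate j
  end.

Definition map_circuit C D m (h : C -> D) (c : circuit C m) : circuit D m :=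
  Circuit [seq (g.1, map (map_vertex h) g.2) | g <- gates c]
    (map_vertex h (output c)).

Definition encode_vertex m (v : vertex int m) : seq nat :=
  match v with
  | Var i => [:: 0%N; nat_of_ord i]
  | Const (Posz k) => [:: 1%N; k]
  | Const (Negz k) => [:: 2%N; k]
  | Gate j => [:: 3%N; j]
  end.

Definition encode_gate m (g : gate int m) : seq nat :=
  (if g.1 is Plus then 0%N else 1%N) :: size g.2 ::
    flatten (map (@encode_vertex m) g.2).

Definition encode_circuit m (c : circuit int m) : seq nat :=
  size (gates c) ::
    flatten (map (@encode_gate m) (gates c)) ++ encode_vertex (output c).

(* Some fixed program writes down, in time polynomial in [n], circuits with
   integer constants for the [n] coordinates of [G n].  It is given [n] and the
   seed length [l n], since for an arbitrary real exponent the latter need not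
   be a computable function of [n]. *)
Definition explicit (F : fieldType) (l : nat -> nat)
    (G : poly_map_seq F l) : Prop :=
  exists (P : cmd) (k : nat), forall n,
    exists (cs : n.-tuple (circuit int (l n))) (t : nat) (s : memory),
      [/\ exec P (input2 n (l n))
            (flatten [seq encode_circuit c | c <- cs]) t s,
          (t <= n ^ k + k)%N
        & forall i : 'I_n,
            computes (map_circuit (fun z : int => z%:~R) (tnth cs i))
              (tnth (G n) i)].

(* [n - n ^ (1 - eps)] rounded down; it is nonnegative for positive [n], and
   [Num.truncn] sends negative numbers to 0. *)
Definition seed_length (R : realType) (eps : R) (n : nat) : nat :=
  Num.truncn (n%:R - exp.powR n%:R (1 - eps)).

(* Main.v *)
(** Put [t := n - l], the number of coordinates exceeding the seed length, and
    let the [i]-th coordinate of the generator be [x_i ^ 2 * x_(i - t)], where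
    variables with index outside [0, l) are replaced by 1.  The coordinates
    split into [t] chains, the residue classes of [i] modulo [t].

    Composition with the generator maps the monomial with exponents [a] to the
    monomial with exponents [2 * a_s + a_(s + t)].  If [a] and [b] have the
    same image, then their difference [d] satisfies [d_(s + t) = - 2 * d_s], so
    along a chain it grows like [2 ^ (n / t)].  Two distinct monomials with the
    same image thus differ by at least [2 ^ (n / t - 1)] in some exponent.
    Since [n / t] is at least about [n ^ eps / 2], polynomially bounded degrees
    rule this out for large [n].  So composition is injective on the monomials
    of [f], and cancellation is impossible, whatever the complexity of [f]. *)

Require Import Defs.
From mathcomp Require Import all_boot all_order all_algebra.
From mathcomp Require Import reals.
From mathcomp Require exp.
From mathcomp Require Import mpoly.
From mathcomp Require Import zify lra.

Set Implicit Arguments.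
Unset Strict Implicit.
Unset Printing Implicit Defensive.

Import Order.TTheory GRing.Theory Num.Theory.

Local Open Scope ring_scope.

(** * The generator, its circuits and its action on monomials *)

Section Generator.

Variable C : Type.

(** The constant is a parameter so that the same circuit serves over [int], for printing, and over
    [F]. *)
Definition var_or_one (one : C) (l j : nat) : vertex C l :=
  if insub j is Some s then Var s else Const one.

Definition chain_circuit (one : C) (l t i : nat) : circuit C l :=
  let v := var_or_one one l i in
  (* Without this test, truncated subtraction would send every [i < t] to index 0. *)
  let w := if (t <= i)%N then var_or_one one l (i - t) else Const one in
  Circuit [:: (Times, [:: v; v]); (Times, [:: Gate 0; w])] (Gate 1).

Lemma var_or_one_below (one : C) l j k : vertex_below k (var_or_one one l j).
Proof. by rewrite /var_or_one; case: insubP. Qed.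

Lemma chain_circuit_wf (one : C) l t i : circuit_wf (chain_circuit one l t i).
Proof.
rewrite /circuit_wf /= !var_or_one_below /=.
by case: ifP => //; rewrite var_or_one_below.
Qed.

End Generator.

Lemma map_chain_circuit (C D : Type) (h : C -> D) one l t i :
  map_circuit h (chain_circuit one l t i) = chain_circuit (h one) l t i.
Proof.
rewrite /map_circuit /chain_circuit /var_or_one /=.
by case: ifP; do ?case: insubP.
Qed.

Definition chain_mnm (l t i : nat) : 'X_{1..l} :=
  [multinom ((i == s) + (i == s) + (i == s + t))%N | s < l].

Section Composition.

Variable F : fieldType.

Lemma var_or_one_val l j (ps : seq {mpoly F[l]}) :
  vertex_val ps (var_or_one 1 l j) =
  'X_[[multinom nat_of_bool (j == s :> nat) | s < l]].
Proof.
rewrite /var_or_one; case: insubP => [s _ <-|/negP jl] /=.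
  by congr 'X_[_]; apply/mnmP => s'; rewrite mnm1E mnmE.
rewrite mpolyC1 -(mpolyX0 l F); congr 'X_[_]; apply/mnmP => s.
by rewrite mnm0E mnmE; case: eqP => // js; case: jl; rewrite js.
Qed.

Lemma chain_circuit_computes l t i :
  computes (chain_circuit (1 : F) l t i) 'X_[chain_mnm l t i].
Proof.
split; first exact: chain_circuit_wf.
rewrite /circuit_val /chain_circuit /= /gate_val /= !big_cons !big_nil /=.
rewrite !mulr1 !var_or_one_val; case: leqP => [ti|it].
  rewrite var_or_one_val -!mpolyXD; congr 'X_[_]; apply/mnmP => s.
  by rewrite !mnmDE !mnmE; congr (_ + nat_of_bool _)%N; lia.
rewrite /= mpolyC1 mulr1 -!mpolyXD; congr 'X_[_]; apply/mnmP => s.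
rewrite !mnmDE !mnmE (_ : (i == s + t)%N = false) ?addn0 //.
by apply/eqP; lia.
Qed.

Lemma mdeg_chain_mnm l t i : (mdeg (chain_mnm l t i) <= 3)%N.
Proof.
have le1 (j : nat) : (\sum_(s < l) (j == s) <= 1)%N.
  case: (ltnP j l) => [jl|lj].
    rewrite (bigD1 (Ordinal jl)) //= eqxx big1 // => s.
    by rewrite -val_eqE /= eq_sym => /negbTE->.
  by rewrite big1 // => s _; have := ltn_ord s; case: eqP => //; lia.
have le1t : (\sum_(s < l) (i == s + t) <= 1)%N.
  case: (leqP t i) => [ti|it].
    apply: leq_trans (le1 (i - t)%N); apply: leq_sum => s _.
    by case: eqP => // ->; rewrite addnK eqxx.
  by rewrite big1 // => s _; case: eqP => //; lia.
rewrite mdegE; under eq_bigr do rewrite mnmE.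
by rewrite !big_split; exact: leq_add (leq_add (le1 i) (le1 i)) le1t.
Qed.

Definition chain_map (l t n : nat) : n.-tuple {mpoly F[l]} :=
  [tuple 'X_[chain_mnm l t i] | i < n].

Definition chain_exponent l t n (a : 'X_{1..n}) : 'X_{1..l} :=
  (\sum_(i < n) chain_mnm l t i *+ a i)%MM.

(** The variable [s] enters only coordinate [s], squared, and coordinate [s + t], to the first
    power. *)
Lemma chain_exponentE l t n (a : 'X_{1..n}) (s : 'I_l) (o p : 'I_n) :
  o = s :> nat -> p = (s + t)%N :> nat ->
  chain_exponent l t a s = (2 * a o + a p)%N.
Proof.
have pick (r : 'I_n) : (\sum_(i < n) (i == r :> nat) * a i = a r)%N.
  rewrite (bigD1 r) //= eqxx mul1n big1 ?addn0 // => i.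
  by rewrite -val_eqE /= => /negbTE->.
move=> os pst; rewrite mnm_sumE.
under eq_bigr do rewrite mulmnE mnmE -pst -os !mulnDl.
by rewrite !big_split /= !pick mul2n addnn.
Qed.

Lemma comp_chain_map l t n (f : {mpoly F[n]}) :
  f \mPo chain_map l t n =
  \sum_(a <- msupp f) f@_a *: 'X_[chain_exponent l t a].
Proof.
rewrite comp_mpolyE; apply: eq_bigr => a _; congr (_ *: _).
by under eq_bigr do rewrite tnth_mktuple; rewrite mprodXnE.
Qed.

End Composition.

(** * Injectivity on monomials of bounded degree *)

Lemma geometric_chain (d : nat -> int) n t j k :
  (forall s, (s + t < n)%N -> d (s + t)%N = - 2 * d s) ->
  (j + k * t < n)%N -> d (j + k * t)%N = (- 2) ^+ k * d j.
Proof.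
move=> step; elim: k => [|k IH] lt_n; first by rewrite mul0n addn0 expr0 mul1r.
rewrite mulSn addnCA addnC step; last by rewrite mulSn in lt_n; lia.
by rewrite IH ?exprS ?mulrA //; rewrite mulSn in lt_n; lia.
Qed.

Lemma chain_exponent_inj l t n (a b : 'X_{1..n}) D :
  (l + t = n)%N -> (0 < n %/ t)%N -> (D < 2 ^ (n %/ t).-1)%N ->
  (mdeg a <= D)%N -> (mdeg b <= D)%N ->
  chain_exponent l t a = chain_exponent l t b -> a = b.
Proof.
move=> ltn nt D_lt aD bD eq_ab.
have t0 : (0 < t)%N by move: nt; case: (t) => //; rewrite divn0.
(* Extending the difference by 0 to all naturals avoids ordinals along a chain. *)
pose d (j : nat) : int :=
  if insub j is Some o then (a o)%:Z - (b o)%:Z else 0.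
have dE (o : 'I_n) : d o = (a o)%:Z - (b o)%:Z by rewrite /d valK.
have d_step s : (s + t < n)%N -> d (s + t)%N = - 2 * d s.
  move=> stn; have sl : (s < l)%N by lia.
  have sn : (s < n)%N by lia.
  move: (congr1 (fun c : 'X_{1..l} => c (Ordinal sl)) eq_ab) => /=.
  rewrite !(@chain_exponentE _ _ _ _ _ (Ordinal sn) (Ordinal stn)) //.
  have := dE (Ordinal sn); have := dE (Ordinal stn); rewrite /= => -> ->; lia.
have mnm_le (c : 'X_{1..n}) (o : 'I_n) : (c o <= mdeg c)%N.
  by rewrite mdegE (bigD1 o) //= leq_addr.
have d_le j : (`|d j| <= D)%N.
  rewrite /d; case: insubP => [o _ _|_] //.
  by have := mnm_le a o; have := mnm_le b o; lia.
(* From a head [j < t], [(n %/ t).-1] steps stay below [n]; a nonzero [d j] would make the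
   difference there at least [2 ^ (n %/ t).-1], hence above [D]. *)
have d0 j : (j < t)%N -> d j = 0.
  move=> jt; have lt_n : (j + (n %/ t).-1 * t < n)%N.
    have := leq_divM n t; rewrite -{1}(prednK nt) mulSn; lia.
  have := d_le (j + (n %/ t).-1 * t)%N.
  rewrite (geometric_chain d_step lt_n) abszM abszX => le_D.
  apply/eqP; rewrite -absz_eq0 -leqn0 leqNgt; apply/negP => d_gt0.
  have := leq_trans D_lt (leq_pmulr _ d_gt0); rewrite ltnNge; apply/negP.
  by rewrite negbK.
(* Each index lies on the chain headed by its residue modulo [t], and [d] vanishes at the head. *)
apply/mnmP => o; have := dE o; rewrite {1}(divn_eq o t) addnC.
rewrite (geometric_chain d_step) ?d0 ?ltn_mod //; first lia.
by rewrite addnC -divn_eq.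
Qed.

Lemma comp_chain_map_eq0 (F : fieldType) l t n (f : {mpoly F[n]}) :
  (l + t = n)%N -> (0 < n %/ t)%N -> ((msize f).-1 < 2 ^ (n %/ t).-1)%N ->
  f \mPo chain_map F l t n = 0 <-> f = 0.
Proof.
move=> ltn nt f_lt; split=> [|->]; last exact: comp_mpoly0.
rewrite comp_chain_map => fG0; apply/mpolyP => a; rewrite mcoeff0.
have [/memN_msupp_eq0 //|/negPn af] := boolP (a \notin msupp f).
have deg_le b : b \in msupp f -> (mdeg b <= (msize f).-1)%N.
  by move/msize_mdeg_lt; case: (msize f).
(* By injectivity [a] alone contributes to this coefficient, which is therefore [f@_a]. *)
have := congr1 (mcoeff (chain_exponent l t a)) fG0.
rewrite linear_sum /= mcoeff0 (bigD1_seq a) ?msupp_uniq //= big_seq_cond.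
rewrite mcoeffZ mcoeffX eqxx mulr1 big1 ?addr0 // => b /andP[bf ba].
rewrite mcoeffZ mcoeffX; case: eqP => [eq_ba|]; last by rewrite mulr0.
move: ba; rewrite (chain_exponent_inj ltn nt f_lt _ _ eq_ba) ?eqxx //;
  exact: deg_le.
Qed.

(** * Growth *)

Lemma leq_exp2rW m n e : (m <= n -> m ^ e <= n ^ e)%N.
Proof. by case: e => // e le_mn; rewrite leq_exp2r. Qed.

(** With [x = B %/ e.+1], [B <= e.+1 * 2 ^ x]; the threshold gives [e.+1 ^ e <= x < 2 ^ x], so
    [B ^ e < 2 ^ (x * e.+1) <= 2 ^ B]. *)
Lemma exp_gt_power e : exists B0, forall B, (B0 <= B)%N -> (B ^ e < 2 ^ B)%N.
Proof.
exists (e.+1 ^ e * e.+1)%N => B B_ge.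
set x := (B %/ e.+1)%N.
have x_ge : (e.+1 ^ e <= x)%N by rewrite leq_divRL.
have B_lt : (B <= e.+1 * 2 ^ x)%N.
  apply: leq_trans (ltnW (ltn_ceil B (ltn0Sn e))) _.
  by rewrite mulnC leq_mul2l ltn_expl.
apply: leq_ltn_trans (_ : (e.+1 * 2 ^ x) ^ e < _)%N; first exact: leq_exp2rW.
apply: leq_trans (_ : 2 ^ (x * e.+1) <= _)%N; last first.
  by rewrite leq_exp2l // leq_divM.
rewrite expnMn mulnS expnD -expnM ltn_pmul2r ?expn_gt0 //.
exact: leq_ltn_trans x_ge (ltn_expl _ _).
Qed.

Lemma addn_le_mulX x k B : (0 < x)%N -> (1 < B)%N -> (x + k <= x * B ^ k)%N.
Proof.
move=> x0 B1; apply: leq_trans (_ : x * k.+1 <= _)%N; first nia.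
by rewrite leq_mul2l ltn_expl // orbT.
Qed.

(** For [B] the number of variables divided by [t], the nested powers bound in turn that number, the
    family index and the degree. *)
Lemma exp_gt_poly q k k' : exists B0, forall B, (B0 <= B)%N ->
  ((((2 * B + 2) ^ q) ^ k' + k') ^ k + k < 2 ^ B.-1)%N.
Proof.
(* For [B >= 3], [2 * B + 2 <= B ^ 2], and each map [x ^ j + j] turns a bound [B ^ e] into
   [B ^ (e * j + j)]. *)
pose E := (((2 * q) * k' + k') * k + k)%N.
(* The extra factor [B] pays for the predecessor in [2 ^ B.-1]. *)
have [B0 B0P] := exp_gt_power E.+1.
exists (B0 + 3)%N => B B_ge; have B3 : (3 <= B)%N by lia.
have X_gt0 e : (0 < B ^ e)%N by rewrite expn_gt0; lia.
have B1 : (1 < B)%N by lia.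
have leX x e j : (x <= B ^ e -> x ^ j + j <= B ^ (e * j + j))%N.
  move=> le_x; apply: leq_trans (_ : (B ^ e) ^ j + j <= _)%N.
    by rewrite leq_add2r leq_exp2rW.
  by rewrite expnD -expnM addn_le_mulX.
have le_E : ((((2 * B + 2) ^ q) ^ k' + k') ^ k + k <= B ^ E)%N.
  apply: (leX); apply: (leX); rewrite expnM leq_exp2rW //; nia.
apply: leq_ltn_trans le_E _.
have := B0P B (leq_trans (leq_addr _ _) B_ge).
case: (B) B1 => // B' B1; rewrite /= [(2 ^ _.+1)%N]expnS expnS; nia.
Qed.

Lemma seed_length_le (R : realType) (eps : R) n : (seed_length eps n <= n)%N.
Proof.
rewrite /seed_length truncn_le_nat.
have := exp.powR_ge0 (n%:R : R) (1 - eps); rewrite -natr1; lra.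
Qed.

(** Put [p = n ^ (1 - eps)] and [r = n ^ (1 / q)]. Then [t < p + 1], [p * r <= n] and [r <= n], so
    [t * r < 2 * n < t * (2 * (n %/ t) + 2)]; cancel [t] and raise to the power [q]. *)
Lemma chain_number_bound (R : realType) (eps : R) (q n : nat) :
  (0 < q)%N -> 1 <= q%:R * eps -> (0 < n)%N ->
  let t := (n - seed_length eps n)%N in
  (0 < t)%N /\ (n <= (2 * (n %/ t) + 2) ^ q)%N.
Proof.
move=> q0 q_eps n0; set l := seed_length eps n; set t := (n - l)%N.
have ln : (l <= n)%N := seed_length_le eps n.
set r : R := exp.powR n%:R q%:R^-1; set p : R := exp.powR n%:R (1 - eps).
have n1 : 1 <= (n%:R : R) by rewrite ler1n.
have q0R : 0 < (q%:R : R) by rewrite ltr0n.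
have r_gt0 : 0 < r by apply: exp.powR_gt0; lra.
have p_gt0 : 0 < p by apply: exp.powR_gt0; lra.
have rq : r ^+ q = n%:R.
  rewrite -exp.powR_mulrn ?exp.powR_ge0 // -exp.powRrM mulVf ?exp.powRr1 //.
  by rewrite gt_eqF.
have r_le_n : r <= n%:R.
  rewrite -[leRHS]exp.powRr1; last lra.
  by apply: exp.ler_powR => //; rewrite invf_le1 // ler1n.
have pr_le_n : p * r <= n%:R.
  rewrite -exp.powRD; last by rewrite pnatr_eq0 -lt0n n0 implybT.
  rewrite -[leRHS]exp.powRr1; last lra.
  apply: exp.ler_powR => //; suff : q%:R^-1 <= eps by lra.
  by rewrite -(ler_pM2l q0R) mulfV // gt_eqF.
have tE : (t%:R : R) = n%:R - l%:R by rewrite natrB.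
have t0 : (0 < t)%N.
  rewrite subn_gt0 /l /seed_length; case: (leP 0 (n%:R - p)) => [x0|/ltW x0].
    by rewrite -/p truncn_lt_nat //; lra.
  by rewrite (truncn0Pn _ _) // -/p -ltNge; lra.
split=> //.
have t_lt : (t%:R : R) < p + 1.
  have := truncnS_gt (n%:R - p); rewrite -/l -natr1 tE; lra.
have n_lt : (n%:R : R) < t%:R * (n %/ t + 1)%:R.
  by rewrite -natrM ltr_nat addn1 mulnC ltn_ceil.
have tr_lt : t%:R * r < t%:R * (2 * (n %/ t) + 2)%:R.
  apply: lt_trans (_ : 2 * n%:R < _); first nra.
  rewrite (_ : 2 * (n %/ t) + 2 = 2 * (n %/ t + 1))%N; last lia.
  by rewrite natrM; lra.
rewrite -(ler_nat R) -rq natrX lerXn2r ?nnegrE ?ler0n ?(ltW r_gt0) //.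
by rewrite ltr_pM2l ?ltr0n // in tr_lt; exact: ltW.
Qed.

(** * The program *)

Definition cell (a : nat) : expr := Cell (Lit a).

Fixpoint emit_all (e : expr) (es : seq expr) : cmd :=
  if es is e' :: es' then Seq (Emit e) (emit_all e' es') else Emit e.

(** Truncated subtraction serves as the strict comparison of [e] with the seed length. *)
Definition emit_var_or_one (e : expr) : cmd :=
  If (Defs.Sub (cell 1) e) (emit_all (Lit 0) [:: e])
                      (emit_all (Lit 1) [:: Lit 1]).

(* Index [l] is out of range, so [emit_var_or_one (cell 1)] emits the constant
   1, in the same time as a variable. *)
Definition emit_lagged_var : cmd :=
  let t := Defs.Sub (cell 0) (cell 1) in
  If (Defs.Sub (Add (cell 2) (Lit 1)) t)
     (emit_var_or_one (Defs.Sub (cell 2) t))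
     (emit_var_or_one (cell 1)).

(* Cell 0 holds [n], cell 1 holds [l], and cell 2 is the loop counter [i]. *)
Definition chain_body : cmd :=
  Seq (emit_all (Lit 2) [:: Lit 1; Lit 2])
 (Seq (emit_var_or_one (cell 2))
 (Seq (emit_var_or_one (cell 2))
 (Seq (emit_all (Lit 1) [:: Lit 2; Lit 3; Lit 0])
 (Seq emit_lagged_var
 (Seq (emit_all (Lit 3) [:: Lit 1])
      (Store (Lit 2) (Add (cell 2) (Lit 1)))))))).

Definition chain_program : cmd := While (Defs.Sub (cell 0) (cell 2)) chain_body.

Lemma exec_emit_all e es s :
  exec (emit_all e es) s (map (expr_val s) (e :: es)) (size es).+1 s.
Proof.
elim: es e => [|e' es IH] e /=; first exact: ExecEmit.
exact: ExecSeq (ExecEmit e s) (IH e').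
Qed.

Lemma exec_emit_var_or_one e s :
  exec (emit_var_or_one e) s
    (encode_vertex (var_or_one (1 : int) (s 1%N) (expr_val s e))) 3 s.
Proof.
rewrite /var_or_one; case: insubP => [o lt_l o_e|/negP ge_l].
  apply: ExecIfTrue; first by rewrite /= subn_eq0 -ltnNge.
  by rewrite /= o_e; exact: exec_emit_all (Lit 0) [:: e] s.
apply: ExecIfFalse; first by apply/eqP; rewrite /= subn_eq0 leqNgt; apply/negP.
exact: exec_emit_all (Lit 1) [:: Lit 1] s.
Qed.

Lemma exec_emit_lagged_var s :
  let t := (s 0%N - s 1%N)%N in
  exec emit_lagged_var s
    (encode_vertex
       (if (t <= s 2%N)%N then var_or_one (1 : int) (s 1%N) (s 2%N - t)
        else Const 1)) 4 s.
Proof.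
move=> t; case: leqP => [t_le|t_gt].
  apply: ExecIfTrue; first by rewrite /= -/t; lia.
  exact: exec_emit_var_or_one.
apply: ExecIfFalse; first by rewrite /= -/t; lia.
have := exec_emit_var_or_one (cell 1) s.
by rewrite {1}/var_or_one insubN //= ltnn.
Qed.

(** The time is the same on all branches: 3 + 3 + 3 + 4 + 4 + 2 + 1 = 20. *)
Lemma exec_chain_body s :
  exec chain_body s
    (encode_circuit (chain_circuit (1 : int) (s 1%N) (s 0%N - s 1%N) (s 2%N))) 20
    (update s 2%N (s 2%N).+1).
Proof.
have seq := ExecSeq; have em := exec_emit_all.
have v := exec_emit_var_or_one (cell 2) s.
have := seq _ _ _ _ _ _ _ _ _ (em (Lit 2) [:: Lit 1; Lit 2] s)
  (seq _ _ _ _ _ _ _ _ _ v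
  (seq _ _ _ _ _ _ _ _ _ v
  (seq _ _ _ _ _ _ _ _ _ (em (Lit 1) [:: Lit 2; Lit 3; Lit 0] s)
  (seq _ _ _ _ _ _ _ _ _ (exec_emit_lagged_var s)
  (seq _ _ _ _ _ _ _ _ _ (em (Lit 3) [:: Lit 1] s)
    (ExecStore (Lit 2) (Add (cell 2) (Lit 1)) s)))))).
by rewrite /encode_circuit /encode_gate /= !cats0 (addn1 (s 2%N)) -!catA.
Qed.

(** Induction on the [k] rounds left: each costs 20 steps and a loop test, and the failing test adds
    the final 1. *)
Lemma exec_chain_program n l k i s :
  s 0%N = n -> s 1%N = l -> s 2%N = i -> (i + k = n)%N ->
  exists s', exec chain_program s
    (flatten [seq encode_circuit (chain_circuit (1 : int) l (n - l) j)
             | j <- iota i k]) (21 * k).+1 s'.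
Proof.
elim: k i s => [|k IH] i s s0 s1 s2 ikn.
  by exists s; apply: ExecWhileFalse; rewrite /= s0 s2; lia.
have [||||s' exec_s'] := IH i.+1 (update s 2%N i.+1); rewrite //; first lia.
exists s'; rewrite (_ : (21 * k.+1).+1 = (20 + (21 * k).+1).+1)%N; last lia.
have := exec_chain_body s; rewrite s0 s1 s2 => exec_body.
by apply: ExecWhileTrue exec_body exec_s'; rewrite /= s0 s2; lia.
Qed.

(** The summand [k.+1] settles [n <= 1]; for larger [n], [n ^ k >= k >= 22] gives
    [n ^ k.+1 >= 22 * n]. *)
Lemma linear_le_power n k :
  (22 <= k -> (21 * n).+1 <= n ^ k.+1 + k.+1)%N.
Proof.
move=> k_ge.
have [->|[->|n_gt1]] : (n = 0 \/ n = 1 \/ 1 < n)%N by lia.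
- by rewrite muln0 addnS.
- by rewrite muln1; apply: leq_trans (leqW k_ge) (leq_addl _ _).
have : (k <= n ^ k)%N.
  by apply: leq_trans (ltnW (ltn_expl k (ltnSn 1))) _; exact: leq_exp2rW.
rewrite expnS; nia.
Qed.

(** * Explicitness, constant circuit size and the hitting property *)

Lemma chain_map_explicit (F : fieldType) (l : nat -> nat) :
  explicit (fun n => chain_map F (l n) (n - l n) n).
Proof.
exists chain_program, 30 => n.
have [||||s exec_s] := @exec_chain_program n (l n) n 0 (input2 n (l n)) => //.
exists [tuple chain_circuit (1 : int) (l n) (n - l n) i | i < n], (21 * n).+1, s.
split.
- rewrite (_ : map _ _ = [seq encode_circuit (chain_circuit 1 (l n) (n - l n) j)
                         | j <- iota 0 n]) //.
  by rewrite -val_enum_ord -!map_comp.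
- exact: (@linear_le_power n 29).
- move=> i; rewrite !tnth_mktuple map_chain_circuit.
  exact: chain_circuit_computes.
Qed.

Lemma chain_map_VNC0 (F : fieldType) (l : nat -> nat) :
  coordinates_in (@VNC0 F) (fun n => chain_map F (l n) (n - l n) n).
Proof.
move=> i; split.
  exists 3 => n; rewrite tnth_mktuple msizeX /=.
  exact: leq_trans (mdeg_chain_mnm _ _ _) (leq_addl _ _).
exists 2 => n; exists (chain_circuit 1 (l n.+1) (n.+1 - l n.+1) (i n)).
by rewrite tnth_mktuple; split=> //; exact: chain_circuit_computes.
Qed.

(** The degree is polynomial in [n], [n] in [m n], and [m n] in the chain length [B]; so the degree
    is eventually below [2 ^ B.-1]. *)
Lemma chain_map_hits_p_families (F : fieldType) (R : realType) (eps : R) :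
  0 < eps ->
  hits (@p_family F) (fun n => chain_map F (seed_length eps n)
                                 (n - seed_length eps n) n).
Proof.
move=> eps_gt0 m f [k' n_le] [k deg_le].
have [q q0 q_eps] : exists2 q, (0 < q)%N & 1 <= q%:R * eps.
  exists (Num.truncn eps^-1).+1 => //.
  by rewrite -ler_pdivrMr // div1r ltW // truncnS_gt.
have [B0 B0P] := exp_gt_poly q k k'.
(* Beyond every value of [n] that [n_le_B] permits while [B < B0.+2], and large enough to exclude
   [m n = 0]. *)
exists ((((2 * B0.+2 + 2) ^ q) ^ k' + k').+1) => n n_ge.
set t := (m n - seed_length eps (m n))%N; set B := (m n %/ t)%N.
have m0 : (0 < m n)%N.
  rewrite lt0n; apply/negP => /eqP m0; have n_small := n_le n.
  rewrite m0 in n_small.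
  have : (0 ^ k' <= ((2 * B0.+2 + 2) ^ q) ^ k')%N by exact: leq_exp2rW.
  lia.
have [t0 m_le] := chain_number_bound q0 q_eps m0.
rewrite -/t -/B in t0 m_le.
have n_le_B : (n <= ((2 * B + 2) ^ q) ^ k' + k')%N.
  by apply: leq_trans (n_le n) _; rewrite leq_add2r leq_exp2rW.
have B_ge : (B0.+2 <= B)%N.
  rewrite leqNgt; apply/negP => B_lt; move: n_ge; rewrite leqNgt => /negP; apply.
  rewrite ltnS (leq_trans n_le_B) // leq_add2r !leq_exp2rW //; lia.
apply: comp_chain_map_eq0.
- by rewrite subnKC // seed_length_le.
- by rewrite -/B; lia.
- apply: leq_ltn_trans (deg_le n) (leq_ltn_trans _ (B0P B _)); last lia.
  by rewrite leq_add2r leq_exp2rW.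
Qed.

Theorem theorem4p3 (F : fieldType) (charF : [pchar F] =i pred0)
    (R : realType) (eps : R) (eps_gt0 : 0 < eps) :
  exists G : poly_map_seq F (seed_length eps),
    explicit G /\ computable_hsg (@VNC0 F) (@VAC0 F) G.
Proof.
exists (fun n => chain_map F (seed_length eps n) (n - seed_length eps n) n).
split; first exact: chain_map_explicit.
split; first exact: chain_map_VNC0.
move=> m f m_large [f_p _].
exact: chain_map_hits_p_families.
Qed.
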